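(* Let $L\ge 1$, let $\lambda_1,\dots,\lambda_L\ge 1$ be integers and let $b=b_1\otimes b_2\otimes\cdots\otimes b_L\in B_{\lambda_1}\otimes B_{\lambda_2}\otimes\cdots\otimes B_{\lambda_L}$ be an arbitrary path (highest weight or not). Set $N=E_1(b)=\sum_{j=1}^L E_{1,j}$. Determine pairs of integers $(\mu_1,r_1),(\mu_2,r_2),\dots,(\mu_N,r_N)$ by the following procedure. Step 1. Draw the local energy distribution of $b$, i.e. the table with rows $l=1,2,3,\dots$ and columns $j=1,\dots,L$ whose entry at position $(l,j)$ is $E_{l,j}-E_{l-1,j}\in\{0,1\}$. Step 2. Starting from the rightmost $1$ in the row $l=1$, pick one $1$ from each successive row; the $1$ picked in row $l+1$ must be weakly to the right of the one picked in row $l$. If there is no such $1$ in row $l+1$, stop, and call the position (row, column) of the last picked $1$ $(\mu_1,j_1)$. Change all the picked $1$'s into $0$. Step 3. Repeat Step 2 a further $N-1$ times to determine $(\mu_2,j_2),\dots,(\mu_N,j_N)$, thereby turning all $1$'s of the table into $0$. Step 4. Determine $r_1,\dots,r_N$ by $$r_k=\sum_{i=1}^{j_k-1}\min(\mu_k,\lambda_i)+E_{\mu_k,j_k}-2\sum_{i=1}^{j_k}E_{\mu_k,i},$$ where the $E_{l,j}$ are the local energies of the original path $b$. Then the resulting $(\lambda,(\mu,r))$, with quantum space $\lambda=(\lambda_1,\dots,\lambda_L)$ and configuration the multiset of rows $\mu_k$ with attached riggings $r_k$ ($1\le k\le N$), coincides with the (unrestricted) rigged configuration $\phi(b)$.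
   Context: Crystals and paths. For $k\ge 1$, $B_k=\{(x_1,x_2)\in\mathbb{Z}_{\ge 0}^2 : x_1+x_2=k\}$; the element $(x_1,x_2)$ is identified with the one-row semistandard tableau $1^{x_1}2^{x_2}$. Put $u_l=(l,0)\in B_l$. Elements of tensor products $B_{\lambda_1}\otimes\cdots\otimes B_{\lambda_L}$ (formal sequences $b_1\otimes\cdots\otimes b_L$ with $b_i\in B_{\lambda_i}$) are called paths. Combinatorial $R$ and energy function. For $x=(x_1,x_2)\in B_k$ and $y=(y_1,y_2)\in B_l$, the combinatorial $R$ is the bijection $B_k\otimes B_l\to B_l\otimes B_k$, written $x\otimes y\simeq\tilde y\otimes\tilde x$, given by $\tilde x_i=x_i+Q_i(x,y)-Q_{i-1}(x,y)$, $\tilde y_i=y_i+Q_{i-1}(x,y)-Q_i(x,y)$, where $Q_i(x,y)=\min(x_{i+1},y_i)$ and indices are taken in $\mathbb{Z}/2\mathbb{Z}$. The energy function is $H(x\otimes y)=Q_0(x,y)=\min(x_1,y_2)$. Local energies. For a path $b=b_1\otimes\cdots\otimes b_L$ and $l\ge 1$, set $u_l^{(0)}=u_l$ and define recursively $u_l^{(j)}\in B_l$ by $u_l^{(j-1)}\otimes b_j\simeq b_j'\otimes u_l^{(j)}$ for $1\le j\le L$. The local energy is $E_{l,j}=H(u_l^{(j-1)}\otimes b_j)$, with $E_{0,j}=0$; and $E_l=E_l(b)=\sum_{j=1}^L E_{l,j}$. One has $E_{l,j}-E_{l-1,j}\in\{0,1\}$ for all $l\ge1$, $1\le j\le L$.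 Rigged configurations and the map $\phi$ (Kerov–Kirillov–Reshetikhin, extended to unrestricted paths). A rigged configuration here is a pair $((\lambda_i)_i,(\mu_j,r_j)_{j=1}^N)$, where $\lambda=(\lambda_i)$ is the quantum space (multiset of row lengths) and $(\mu_j,r_j)$ is a multiset of rows of length $\mu_j\ge 1$ each with an integer rigging $r_j$. The vacancy number for $k>0$ is $p_k=\sum_i\min(k,\lambda_i)-2\sum_{j}\min(k,\mu_j)$. A row $\mu_j$ is singular if $r_j=p_{\mu_j}$. The image $\phi(b)$ of $b=b_1\otimes\cdots\otimes b_L$ is constructed recursively, starting from the empty rigged configuration and processing $b_1,b_2,\dots,b_L$ in this order. To process $b_i=(x_1,x_2)$, start a new quantum space row of length $0$ and treat its letters one at a time, first the $x_2$ letters $2$ and then the $x_1$ letters $1$. For a letter $2$: with vacancy numbers computed from the current data, choose a longest singular row of the configuration (if there is no singular row, create a new row of length $0$ and choose it); add one box to the chosen row and one box to the current quantum space row; set the rigging of the chosen row equal to the new vacancy number for its new length (computed from the updated data), leaving all other riggings unchanged. For a letter $1$: add one box to the current quantum space row and leave the configuration and all riggings unchanged. *)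

(* Defs.v *)
From mathcomp Require Import all_boot all_order all_algebra.

Set Implicit Arguments.
Unset Strict Implicit.
Unset Printing Implicit Defensive.

Import GRing.Theory.

(* (x_1, x_2) is the pair (x.1, x.2), the one-row tableau 1^{x_1} 2^{x_2}. *)
Definition B (k : nat) : pred (nat * nat) := fun x => x.1 + x.2 == k.

Definition u_ (l : nat) : nat * nat := (l, 0).

(* Q_i(x, y) = min(x_{i+1}, y_i) with indices modulo 2. *)
Definition Q0 (x y : nat * nat) : nat := minn x.1 y.2.
Definition Q1 (x y : nat * nat) : nat := minn x.2 y.1.

(* combR x y = (y~, x~), for x (x) y ~ y~ (x) x~.  Each truncated subtraction
   is exact, because Q0 is at most x.1 and y.2, and Q1 at most x.2 and y.1. *)
Definition combR (x y : nat * nat) : (nat * nat) * (nat * nat) :=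
  let q0 := Q0 x y in let q1 := Q1 x y in
  ((y.1 + q0 - q1, y.2 + q1 - q0), (x.1 + q1 - q0, x.2 + q0 - q1)).

Definition H (x y : nat * nat) : nat := Q0 x y.

(* u_l^{(j)}: what u_l has become after passing through the first j factors. *)
Definition carrier (b : seq (nat * nat)) (l j : nat) : nat * nat :=
  foldl (fun u y => (combR u y).2) (u_ l) (take j b).

(* Here and below the columns (the tensor factors) are numbered from 0:
   the factor b_{j+1} and the local energy E_{l,j+1} of the usual numbering
   are nth _ b j and E b l j.  The rows l of the table are numbered from 1. *)
Definition E (b : seq (nat * nat)) (l j : nat) : nat :=
  if l is 0 then 0 else H (carrier b l j) (nth (0, 0) b j).

Definition Etot (b : seq (nat * nat)) (l : nat) : nat :=
  \sum_(j < size b) E b l j.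

Definition table := nat -> nat -> int.

Definition energy_table (b : seq (nat * nat)) : table :=
  fun l j => ((E b l j)%:Z - (E b l.-1 j)%:Z)%R.

Definition is_one (L : nat) (T : table) (l j : nat) : bool :=
  (j < L) && (T l j == 1%R).

(* c lists the columns of the 1's picked in the rows 1, 2, ..., size c. *)
Definition selection (L : nat) (T : table) (c : seq nat) : Prop :=
  [/\ 0 < size c,
      forall i, i < size c -> is_one L T i.+1 (nth 0 c i),
      forall j, head 0 c < j -> ~~ is_one L T 1 j,
      sorted leq c
    & forall j, last 0 c <= j -> ~~ is_one L T (size c).+1 j].

Definition erase (T : table) (c : seq nat) : table :=
  fun l j => if (0 < l <= size c) && (j == nth 0 c l.-1) then 0%R else T l j.

(* procedure L T s T': starting from T, size s successive selections (with
   arbitrary admissible choices) can end at the positions listed in s, in this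
   order, and leave the table T'. *)
Inductive procedure (L : nat) : table -> seq (nat * nat) -> table -> Prop :=
| Procedure_stop T : procedure L T [::] T
| Procedure_select T c s T' :
    selection L T c -> procedure L (erase T c) s T' ->
    procedure L T ((size c, last 0 c) :: s) T'.

(* In terms of the column number j + 1 counted from 1, the sums run over
   1 <= i <= j and 1 <= i <= j + 1. *)
Definition rigging (lam : seq nat) (b : seq (nat * nat)) (mu j : nat) : int :=
  ((\sum_(i < j) minn mu (nth 0 lam i))%:Z + (E b mu j)%:Z
   - 2 * (\sum_(i < j.+1) E b mu i)%:Z)%R.

(* Quantum space, and rows (length, rigging).  Both lists stand for multisets. *)
Definition rigged_conf := (seq nat * seq (nat * int))%type.

Definition same_rc (rc rc' : rigged_conf) : bool :=
  perm_eq rc.1 rc'.1 && perm_eq rc.2 rc'.2.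

Definition vacancy (lam mu : seq nat) (k : nat) : int :=
  ((\sum_(a <- lam) minn k a)%:Z - 2 * (\sum_(m <- mu) minn k m)%:Z)%R.

Definition singular (rc : rigged_conf) (row : nat * int) : bool :=
  row.2 == vacancy rc.1 (unzip1 rc.2) row.1.

(* The head of the quantum space is the row under construction. *)
Definition grow_quantum (lam : seq nat) : seq nat :=
  if lam is a :: lam' then a.+1 :: lam' else [::].

Definition letter1 (rc : rigged_conf) : rigged_conf :=
  (grow_quantum rc.1, rc.2).

(* All longest singular rows are equal as (length, rigging) pairs, so it does
   not matter which one is chosen.  Without any singular row, m = 0 is the
   length of the newly created row. *)
Definition letter2 (rc : rigged_conf) : rigged_conf :=
  let sing := filter (singular rc) rc.2 in
  let m := \max_(row <- sing) row.1 in
  let others := if nilp sing then rc.2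
                else rem (m, vacancy rc.1 (unzip1 rc.2) m) rc.2 in
  let lam' := grow_quantum rc.1 in
  (lam', (m.+1, vacancy lam' (m.+1 :: unzip1 others) m.+1) :: others).

Definition process (rc : rigged_conf) (x : nat * nat) : rigged_conf :=
  iter x.1 letter1 (iter x.2 letter2 (0 :: rc.1, rc.2)).

Definition phi (b : seq (nat * nat)) : rigged_conf :=
  foldl process ([::], [::]) b.

(* Main.v *)
Require Import Defs.
From mathcomp Require Import all_boot all_order all_algebra zify.

(** Let d_l be the number of letters 1 in the carrier of capacity l minus the
same number for capacity l - 1.  It is 0 or 1, and all the d_l are 1 before
the first factor.  Passing a factor (y_1, y_2) turns the first y_2 ones of the
word d_1 d_2 ... into zeros and, simultaneously, the first y_1 zeros into ones
([bit_roomS]); the 1's in the corresponding column of the energy table are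
exactly the positions that went from one to zero ([hitE]).  Hence the 1's of
row l alternate in time with the returns of d_l to one, and since zeros are
refilled from the left, d_(l+1) cannot fall twice without d_l falling in
between: every 1 of row l + 1 has, weakly to its left, a 1 of row l that lies
strictly to the right of all earlier 1's of row l + 1 ([interlaced_hit]).

In such an interlaced table the procedure has no freedom: each selection takes
the last 1 in each row that it visits ([selection_last]), and what remains is
interlaced.  The positions found are therefore the chain ends of the table,
the 1's of a row l that are followed by no 1 of row l + 1 before the next 1 of
row l ([procedureP]).

It remains to see that the chain ends, with the riggings given by the energies,
compute phi; this is done letter by letter, the last factor being (0, a) while
its letters 2 are read and (i, x_2) after that.  A letter 1 changes no energy.
A letter 2 adds one 1 to the table, in the last column and in row m + 1, where
m + 1 is the first capacity whose carrier still has a letter 1; this replaces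
the chain end at the last 1 of row m, if m > 0, by one in row m + 1
([chain_end_add]).  On the other side, the vacancy number minus the rigging of
a row of length l is at least the number of letters 1 left in the carrier of
capacity l ([room_gap]), so a singular row has length at most m; and at the
last 1 of row m this bound is attained ([room_gap_eq]).  So the row lengthened
by phi is the one that the table lengthens. *)

Set Implicit Arguments.
Unset Strict Implicit.
Unset Printing Implicit Defensive.

(* without this, simplification would replace E b l.+1 j by its definition *)
Local Arguments E : simpl never.

(** * Interlaced tables and the selection procedure *)

Definition interlaced (m : nat -> nat -> bool) : Prop :=
  forall l y, 0 < l -> m l.+1 y ->
  exists x, [/\ m l x, x <= y & forall y', m l.+1 y' -> y' < y -> y' < x].

(** Selections jump from a 1 of row l to a 1 of row l + 1 before the next 1 of
row l; a chain end is a 1 from which no such jump is possible. *)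
Definition chain_end (m : nat -> nat -> bool) (p : nat * nat) : Prop :=
  [/\ 0 < p.1, m p.1 p.2
    & forall y, m p.1.+1 y -> p.2 <= y -> exists2 x, m p.1 x & p.2 < x <= y].

Lemma is_one_erase L T c l j :
  is_one L (erase T c) l j =
  is_one L T l j && ~~ ((0 < l <= size c) && (j == nth 0 c l.-1)).
Proof. by rewrite /is_one /erase; case: ifP => _; rewrite ?andbT ?andbF. Qed.

(** A later 1 of row i + 2 would require a 1 of row i + 1 strictly to the right
of the pick in row i + 2, hence of the pick in row i + 1. *)
Lemma selection_last L T c : interlaced (is_one L T) -> selection L T c ->
  forall i j, i < size c -> is_one L T i.+1 j -> j <= nth 0 c i.
Proof.
move=> mI [_ c_one c_head c_sorted _]; elim=> [|i IHi] j lt_i one_j.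
  rewrite nth0 leqNgt; apply/negP => /c_head.
  by rewrite one_j.
rewrite leqNgt; apply/negP => lt_cj.
have [x [one_x _ x_gt]] := mI i.+1 j isT one_j.
have lt_cx := x_gt _ (c_one _ lt_i) lt_cj.
have le_x := IHi x (ltnW lt_i) one_x.
have := sorted_leq_nth leq_trans leqnn 0 c_sorted i i.+1.
by rewrite !inE (ltnW lt_i) lt_i => /(_ isT isT (leqnSn i)); lia.
Qed.

Section Erase.

Variables (L : nat) (T : table) (c : seq nat).
Hypotheses (mI : interlaced (is_one L T)) (selc : selection L T c).

Let c_last := selection_last mI selc.
Let c_one : forall i, i < size c -> is_one L T i.+1 (nth 0 c i).
Proof. by case: selc. Qed.
Let c_mono i : i.+1 < size c -> nth 0 c i <= nth 0 c i.+1.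
Proof.
case: selc => _ _ _ c_sorted _ lt_i.
have := sorted_leq_nth leq_trans leqnn 0 c_sorted i i.+1.
by rewrite !inE (ltnW lt_i) lt_i => /(_ isT isT (leqnSn i)).
Qed.
Let c_stop j : nth 0 c (size c).-1 <= j -> ~~ is_one L T (size c).+1 j.
Proof. by case: selc => _ _ _ _ c_stop; rewrite nth_last; apply: c_stop. Qed.

Lemma interlaced_erase : interlaced (is_one L (erase T c)).
Proof.
case=> [//|l] y _; rewrite is_one_erase => /andP [one_y y_kept].
have [x [one_x le_xy x_gt]] := @mI l.+1 y isT one_y.
exists x; split => //; last first.
  by move=> y'; rewrite is_one_erase => /andP [one_y' _]; apply: x_gt.
rewrite is_one_erase one_x /=; apply/negP => /andP [lt_l /eqP def_x].
have [lt_Sl | ge_Sl] := ltnP l.+1 (size c).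
  (* the pick of row l.+2 lies strictly to the right of y, so a 1 of row l.+1
     would have to lie to the right of x, the last one *)
  have le_y := c_last lt_Sl one_y.
  have ne_y : y != nth 0 c l.+1 by move: y_kept; rewrite /= lt_Sl.
  have [x' [one_x' _ x'_gt]] := @mI l.+1 _ isT (c_one lt_Sl).
  have := c_last lt_l one_x'; have := x'_gt y one_y; simpl in *; lia.
have def_l : l = (size c).-1 by lia.
have /negP[] : ~~ is_one L T (size c).+1 y.
  by apply: c_stop; rewrite -def_l -[l]/(l.+1.-1) -def_x.
by move: one_y; rewrite def_l prednK //; lia.
Qed.

(** Each selection accounts for exactly one chain end, the place where it stops:
its other picks are continued by the next pick, and since only last 1's
disappear, no other 1 gains or loses a continuation. *)
Lemma chain_end_erase p :
  chain_end (is_one L T) p <->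
  p = (size c, last 0 c) \/ chain_end (is_one L (erase T c)) p.
Proof.
have c_gt0 : 0 < size c by case: selc.
have lastE : last 0 c = nth 0 c (size c).-1 by rewrite nth_last.
case: p => [l j]; split; rewrite /chain_end /=.
  case=> l_gt0 one_j end_j.
  have [/andP [/andP [_ le_l] /eqP def_j] | kept] :=
    boolP ((0 < l <= size c) && (j == nth 0 c l.-1)).
    left; have [lt_l | ge_l] := ltnP l (size c).
      have [x one_x /andP [lt_x _]] : exists2 x, is_one L T l x & j < x <= nth 0 c l.
        apply: end_j; first exact: c_one.
        rewrite def_j -[in X in _ <= X](prednK l_gt0).
        by apply: c_mono; rewrite prednK.
      case: l {le_l end_j} l_gt0 lt_l def_j one_x one_j => [//|l] _ lt_l def_j one_x _.
      by have := c_last (ltnW lt_l) one_x; simpl in *; lia.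
    have def_l : l = size c by lia.
    by rewrite def_j lastE def_l.
  right; split => //; first by rewrite is_one_erase one_j kept.
  move=> y; rewrite is_one_erase => /andP [one_y y_kept] le_jy.
  have [x one_x /andP[lt_jx le_xy]] := end_j y one_y le_jy.
  exists x; last by rewrite lt_jx.
  rewrite is_one_erase one_x /=; apply/negP => /andP [/andP [_ le_l] /eqP def_x].
  have [lt_l | ge_l] := ltnP l (size c).
    have le_y := c_last lt_l one_y.
    have ne_y : y != nth 0 c l by move: y_kept; rewrite /= lt_l.
    have [x' [one_x' _ x'_gt]] := mI l_gt0 (c_one lt_l).
    have lt_l1 : l.-1 < size c by lia.
    have := x'_gt y one_y; have := c_last lt_l1 (j := x').
    by rewrite prednK // => /(_ one_x'); simpl in *; lia.
  have def_l : l = size c by lia.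
  by have := @c_stop y; rewrite -def_l -def_x le_xy one_y => /(_ isT).
case=> [[-> ->] | [l_gt0]].
  split => //; first by rewrite lastE -{1}(prednK c_gt0); apply: c_one; lia.
  by move=> y one_y le_y; have := @c_stop y; rewrite -lastE le_y one_y => /(_ isT).
rewrite is_one_erase => /andP [one_j j_kept] end_j; split => // y one_y le_jy.
have [y_erased | y_kept] := boolP ((0 < l.+1 <= size c) && (y == nth 0 c l)).
  (* y is the pick of row l.+1, and the pick of row l lies between j and y *)
  case/andP: y_erased => /andP [_ lt_l] /eqP def_y.
  case: l l_gt0 {end_j} lt_l j_kept one_j one_y def_y => [//|l] _ lt_l.
  rewrite /= (ltnW lt_l) /= => ne_j one_j one_y ->.
  exists (nth 0 c l); first exact/c_one/ltnW.
  by rewrite c_mono // ltn_neqAle ne_j (c_last (ltnW lt_l) one_j).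
have [|x] := end_j y _ le_jy; first by rewrite is_one_erase one_y y_kept.
by rewrite is_one_erase => /andP [one_x _] lt_jx; exists x.
Qed.

Lemma chain_end_erased : ~ chain_end (is_one L (erase T c)) (size c, last 0 c).
Proof.
case=> /= c_gt0; rewrite is_one_erase -nth_last c_gt0 leqnn eqxx.
by rewrite andbF.
Qed.

Lemma count_erase :
  \sum_(j < L) is_one L T 1 j = (\sum_(j < L) is_one L (erase T c) 1 j).+1.
Proof.
have c_gt0 : 0 < size c by case: selc.
have one_0 := c_one c_gt0.
have lt_0 : nth 0 c 0 < L by case/andP: one_0.
rewrite (bigD1 (Ordinal lt_0)) //= one_0 add1n; congr _.+1.
rewrite [RHS](bigD1 (Ordinal lt_0)) //= is_one_erase c_gt0 eqxx andbF add0n.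
apply: eq_bigr => j ne_j; rewrite is_one_erase c_gt0 /=.
by move: ne_j; rewrite -val_eqE /= => ->; rewrite andbT.
Qed.

End Erase.

(** A greedy selection can fail to stop only if infinitely many rows have a 1,
so a bound M on the rows is needed. *)
Lemma select_exists L T M : interlaced (is_one L T) ->
    (forall l j, M < l -> ~~ is_one L T l j) ->
  0 < \sum_(j < L) is_one L T 1 j -> exists c, selection L T c.
Proof.
move=> mI m_bounded m_gt0.
have [x0 one_x0] : exists x, is_one L T 1 x.
  move: m_gt0; rewrite lt0n sum_nat_eq0 negb_forall => /existsP [j].
  by case one_j : (is_one L T 1 j) => // _; exists j.
have lt_L l x : is_one L T l x -> x <= L by case/andP => /ltnW.
have [x1 one_x1 last_x1] : exists2 x, is_one L T 1 x & forall j, is_one L T 1 j -> j <= x.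
  have ex_one : exists x, is_one L T 1 x by exists x0.
  by have [x1] := ex_maxnP ex_one (lt_L 1); exists x1.
pose partial c := [/\ 0 < size c, forall i, i < size c -> is_one L T i.+1 (nth 0 c i),
  head 0 c = x1 & sorted leq c].
have extend k : forall c, partial c -> M <= size c + k -> exists c, selection L T c.
  elim: k => [|k IHk] c [c_gt0 c_one c_head c_sorted] le_M.
    exists c; split => // j; last by move=> _; apply: m_bounded; lia.
    by rewrite c_head ltnNge; apply: contra => /last_x1.
  have [/existsP [y /andP [le_y one_y]] | none] :=
    boolP [exists y : 'I_L, (last 0 c <= y) && is_one L T (size c).+1 y].
    apply: (IHk (rcons c y)); last by rewrite size_rcons; lia.
    split; rewrite ?size_rcons //.
    - move=> i; rewrite ltnS leq_eqVlt => /orP [/eqP -> | lt_i].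
        by rewrite nth_rcons ltnn eqxx.
      by rewrite nth_rcons lt_i c_one.
    - by case: (c) c_gt0 c_head.
    - case: (c) c_gt0 c_sorted le_y => //= a c' _ c'_path le_y.
      by rewrite rcons_path c'_path.
  exists c; split => // j.
    by rewrite c_head ltnNge; apply: contra => /last_x1.
  move=> le_j; apply: contra none => one_j.
  have lt_j : j < L by case/andP: one_j.
  by apply/existsP; exists (Ordinal lt_j); rewrite /= le_j.
apply: (extend M [:: x1]); last by rewrite leq_addl.
by split=> // [] [].
Qed.

Lemma no_one_interlaced m :
  interlaced m -> (forall j, ~~ m 1 j) -> forall l j, 0 < l -> ~~ m l j.
Proof.
move=> mI m_1; elim=> [//|[|l] IHl] j _; first exact: m_1.
by apply/negP => /mI [] // x [m_x _ _]; have := IHl x isT; rewrite m_x.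
Qed.

(** Chain ends of the initial table are split between the positions found and
the chain ends of the table that is left, and each selection uses one 1 of the
first row; so after as many selections as there are 1's in the first row, the
positions found are all the chain ends. *)
Lemma procedureP L T s T' : procedure L T s T' -> interlaced (is_one L T) ->
  [/\ interlaced (is_one L T'),
      uniq s,
      forall p, chain_end (is_one L T) p <-> p \in s \/ chain_end (is_one L T') p,
      forall p, p \in s -> ~ chain_end (is_one L T') p
    & \sum_(j < L) is_one L T 1 j = size s + \sum_(j < L) is_one L T' 1 j].
Proof.
elim=> {T s T'} [T | T c s T' selc _ IH] mI.
  by split=> // p; rewrite in_nil; split; [right | case].
have [mI' uniq_s endE s_gone countE] := IH (interlaced_erase mI selc).
split=> //=.
- rewrite uniq_s andbT; apply/negP => s_c.
  by apply: (chain_end_erased (L := L) (T := T) (c := c)); apply/endE; left.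
- move=> p; rewrite (chain_end_erase mI selc) endE inE.
  split=> [[-> | [s_p | end_p]] | [/orP [/eqP -> | s_p] | end_p]];
   rewrite ?eqxx; auto.
  by left; rewrite s_p orbT.
- move=> p; rewrite inE => /orP [/eqP -> | /s_gone //] end_c.
  by apply: (chain_end_erased (L := L) (T := T) (c := c)); apply/endE; right.
- by rewrite (count_erase selc) countE.
Qed.

(** * Carriers and the energy table *)

(** In the box-ball picture the letters 1 of the carrier are its empty places,
which the letters 2 it meets will fill. *)
Definition room (b : seq (nat * nat)) (l j : nat) : nat := (carrier b l j).1.

Definition weight (x : nat * nat) : nat := x.1 + x.2.

Definition hit (b : seq (nat * nat)) (l j : nat) : bool :=
  E b l j == (E b l.-1 j).+1.


Section Carrier.

Variable b : seq (nat * nat).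
Local Notation y j := (nth (0, 0) b j).

Lemma carrierS l j : carrier b l j.+1 = (combR (carrier b l j) (y j)).2.
Proof.
rewrite /carrier; have [lt_j | ge_j] := ltnP j (size b).
  by rewrite (take_nth (0, 0) lt_j) foldl_rcons.
rewrite !take_oversize ?nth_default //; last exact: ltnW.
case: (foldl _ _ _) => c d.
by rewrite /combR /Q0 /Q1 /= !minn0 !addn0 !subn0.
Qed.

Lemma weight_carrier l j : weight (carrier b l j) = l.
Proof.
elim: j => [|j IHj]; first by rewrite /carrier take0 /weight /= addn0.
move: IHj; rewrite carrierS /weight /combR /Q0 /Q1 /=.
by case: (carrier b l j) => c d /=; lia.
Qed.

Lemma room0 l : room b l 0 = l. Proof. by rewrite /room /carrier take0. Qed.

Lemma roomS l j : room b l j.+1 =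
  room b l j + minn (l - room b l j) (y j).1 - minn (room b l j) (y j).2.
Proof.
have := weight_carrier l j; rewrite /room carrierS /weight /combR /Q0 /Q1 /=.
by case: (carrier b l j) => c d /= <-; rewrite addKn.
Qed.

Lemma room_ub l j : room b l j <= l.
Proof. by rewrite -{2}(weight_carrier l j) leq_addr. Qed.

Lemma room_step l j : room b l j <= room b l.+1 j <= (room b l j).+1.
Proof.
elim: j => [|j]; first by rewrite !room0 leqnSn leqnn.
by rewrite !roomS; have := room_ub l j; have := room_ub l.+1 j; lia.
Qed.

Lemma room_mono j : {homo room b ^~ j : l m / l <= m}.
Proof.
by apply: homo_leq leq_trans _ => // l; have /andP [] := room_step l j.
Qed.

(** A carrier of large capacity is never full: each letter 2 takes at most one
place. *)
Lemma room_lb l j : l <= room b l j + \sum_(i < j) (y i).2.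
Proof.
elim: j => [|j]; first by rewrite room0 leq_addr.
by rewrite big_ord_recr /= roomS; have := room_ub l j; lia.
Qed.

Lemma E_room l j : E b l j = minn (room b l j) (y j).2.
Proof.
case: l => [|l] //=; have := room_ub 0 j; rewrite leqn0 => /eqP ->.
by rewrite min0n.
Qed.

Lemma E_default l j : size b <= j -> E b l j = 0.
Proof. by move=> le_j; rewrite E_room nth_default // minn0. Qed.

Lemma E_step l j : E b l j <= E b l.+1 j <= (E b l j).+1.
Proof. by rewrite !E_room; have := room_step l j; lia. Qed.

Lemma hitE l j : hit b l.+1 j =
  (room b l j < room b l.+1 j) && (room b l j < (y j).2).
Proof. by rewrite /hit !E_room /=; have := room_step l j; lia. Qed.

(** With d_l = room l - room (l - 1), which is 0 or 1: a one survives a factor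
(y_1, y_2) unless it is among the first y_2 ones, and a zero becomes a one
when it is among the first y_1 zeros. *)
Lemma bit_roomS l j : (room b l j.+1 < room b l.+1 j.+1) =
  (room b l j < room b l.+1 j) && ((y j).2 <= room b l j) ||
  (room b l.+1 j <= room b l j) && (l - room b l j < (y j).1).
Proof.
rewrite !roomS; have := room_ub l j; have := room_ub l.+1 j.
have := room_step l j; move: (room b l j) (room b l.+1 j) => c c'.
have [lt_c | ge_c] := ltnP c c' => le_c' ub_c' ub_c.
  have -> : c' = c.+1 by lia.
  lia.
have -> : c' = c by lia.
lia.
Qed.

Lemma hit_col l j : hit b l j -> j < size b.
Proof. by rewrite ltnNge /hit; apply: contraL => le_j; rewrite !E_default. Qed.

Lemma hit_bounded l j : \sum_(i < size b) (y i).2 < l -> ~~ hit b l j.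
Proof.
case: l => [//|l]; rewrite ltnS => le_l; apply/negP => hit_l.
have lt_j := hit_col hit_l; move: hit_l; rewrite hitE => /andP [_].
apply/negP; rewrite -leqNgt -(leq_add2r (\sum_(i < j) (y i).2)).
apply: leq_trans (room_lb l j); apply: leq_trans le_l.
rewrite -!(big_mkord xpredT (fun i => (y i).2)).
rewrite [leqRHS](big_cat_nat (leq0n j) (ltnW lt_j)) /= addnC leq_add2l.
by rewrite [leqRHS]big_ltn // leq_addr.
Qed.

(** Between two 1's of row l + 1 the bit d_(l+1) returns to one; in that
column d_l falls or is left at one, because zeros are refilled from the left,
and unless it falls earlier it must fall together with d_(l+1), because ones
are removed from the left. *)
Lemma interlaced_hit : interlaced (hit b).
Proof.
move=> l j l_gt0.
pose fresh n := exists x, [/\ hit b l x, x < n &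
  forall y', hit b l.+1 y' -> y' < n -> y' < x].
have inv n : fresh n \/
    (room b l n < room b l.+1 n -> room b l.-1 n < room b l n).
  elim: n => [|n IHn]; first by right; rewrite !room0; lia.
  have [hit_l1 | no_hit_l1] := boolP (hit b l.+1 n).
    by right; move: hit_l1; rewrite bit_roomS hitE; lia.
  have [hit_l | no_hit_l] := boolP (hit b l n).
    left; exists n; split=> // y' hit_y'; rewrite ltnS leq_eqVlt.
    by case: eqVneq hit_y' => // ->; rewrite (negPf no_hit_l1).
  case: IHn => [[x [hit_x lt_x x_gt]] | room_imp].
    left; exists x; split => //; first exact: ltnW.
    move=> y' hit_y'; rewrite ltnS leq_eqVlt.
    case: eqVneq hit_y' => [-> | _ hit_y']; last exact: x_gt.
    by rewrite (negPf no_hit_l1).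
  right; move: no_hit_l no_hit_l1 room_imp.
  case: l l_gt0 {fresh} => [//|l] _; rewrite !hitE !bit_roomS /=.
  by have := room_step l n; have := room_step l.+1 n; lia.
move=> hit_j; case: (inv j) => [[x [hit_x lt_x x_gt]] | room_imp].
  by exists x; split=> //; apply: ltnW.
exists j; split=> //; move: hit_j room_imp.
case: l l_gt0 {fresh inv} => [//|l] _; rewrite !hitE /=.
by have := room_step l j; have := room_step l.+1 j; lia.
Qed.

(** The two parts of the vacancy number of the first n factors: by induction on
the path, the sum of min(l, mu_j) over the rows is the total energy E_l. *)
Definition width_sum l n := \sum_(i < n) minn l (weight (y i)).
Definition energy_sum l n := \sum_(i < n) E b l i.

(** The right side minus the left side is the vacancy number minus the rigging
of a row of length l ending at column j, less the room of the carrier.  A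
factor of width k and energy E increases the room by at most min(l, k) - 2 E. *)
Lemma room_gap l j n : hit b l j -> j < n ->
  room b l n + 2 * energy_sum l n + (width_sum l j + E b l j)
    <= width_sum l n + 2 * energy_sum l j.+1.
Proof.
move=> hit_j; elim: n => [//|n IHn]; rewrite ltnS leq_eqVlt.
case: eqVneq => [<- _ | _ /= lt_jn]; last first.
  move: (IHn lt_jn); rewrite /energy_sum /width_sum !(big_ord_recr n) /=.
  rewrite roomS (E_room l n) /weight; have := room_ub l n; lia.
rewrite /energy_sum /width_sum !(big_ord_recr j) /= roomS E_room /weight.
have := room_ub l j; case: l hit_j {IHn} => [//|l]; rewrite hitE.
have := room_step l j; lia.
Qed.

(** The assumptions force d_l to stay zero and d_(l+1) to stay one after column
j; then each factor exchanges all of its letters with the places below l + 1,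
so that it changes the room by exactly its width minus 2 E. *)
Lemma room_gap_eq l j n : hit b l j -> j < n ->
    (forall i, j < i < n -> ~~ hit b l i) ->
    (forall i, j <= i < n -> ~~ hit b l.+1 i) ->
    room b l.-1 n = room b l n -> room b l n < room b l.+1 n ->
  room b l n + 2 * energy_sum l n + (width_sum l j + E b l j)
    = width_sum l n + 2 * energy_sum l j.+1.
Proof.
move=> hit_j; elim: n => [//|n IHn]; rewrite ltnS leq_eqVlt.
case: l hit_j IHn => [//|l]; rewrite !hitE => hit_j IHn.
case: eqVneq => [<- _ | _ /= lt_jn] no_hit no_hit1.
  have := no_hit1 j; rewrite leqnn ltnSn => /(_ isT); rewrite hitE.
  rewrite /= bit_roomS (E_room l.+1 j).
  rewrite /energy_sum /width_sum !(big_ord_recr j) /= (E_room l.+1 j) roomS /weight.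
  have := room_step l j; have := room_step l.+1 j; have := room_ub l.+1 j; lia.
have := no_hit n; rewrite lt_jn ltnSn => /(_ isT); rewrite hitE.
have := no_hit1 n; rewrite (ltnW lt_jn) ltnSn => /(_ isT); rewrite hitE.
move: (IHn lt_jn).
have no_hit' i : j < i < n -> ~~ hit b l.+1 i.
  by case/andP=> lt_ji lt_in; apply: no_hit; rewrite lt_ji ltnW.
have no_hit1' i : j <= i < n -> ~~ hit b l.+2 i.
  by case/andP=> lt_ji lt_in; apply: no_hit1; rewrite lt_ji ltnW.
move=> /(_ no_hit' no_hit1') /= IH no_hit1_n no_hit_n full_l full_l1.
have [eq_l lt_l y1_le y2_le] : [/\ room b l n = room b l.+1 n,
    room b l.+1 n < room b l.+2 n, (y n).1 <= l.+1 - room b l.+1 n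
    & (y n).2 <= room b l.+1 n].
  have := room_step l n; have := room_step l.+1 n; have := room_ub l n.
  have := bit_roomS l n; have := bit_roomS l.+1 n; rewrite full_l ltnn full_l1.
  by move: no_hit_n no_hit1_n => *; split; lia.
have := IH eq_l lt_l; rewrite /energy_sum /width_sum !(big_ord_recr n) /= roomS.
rewrite (E_room l.+1 n) (minn_idPr y1_le) (minn_idPr y2_le).
have -> : minn l.+1 (weight (y n)) = (y n).1 + (y n).2.
  by apply/minn_idPr; have := room_ub l.+1 n; rewrite /weight; lia.
lia.
Qed.

End Carrier.

(** * Reading off the rigged configuration letter by letter *)

(** Adding a 1 at the lower end of the last column prolongs one chain only: the
one ending at the last 1 of the row above, at column k.  For l0 = 0 the new 1
starts a chain. *)
Lemma chain_end_add (m m' : nat -> nat -> bool) l0 k L :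
    (forall l j, m' l j = m l j || (l == l0.+1) && (j == L)) ->
    (forall l j, m l j -> j <= L) -> (forall l, m l L -> l <= l0) ->
    interlaced m' ->
    (0 < l0 -> m l0 k /\ forall j, m l0 j -> j <= k) ->
  forall p, chain_end m' p <-> p = (l0.+1, L) \/ chain_end m p /\ p != (l0, k).
Proof.
move=> m'E m_L m_rows m'I last_k [l j]; rewrite /chain_end /=; split.
  case=> l_gt0 m'_j end_j.
  have [[-> ->]|ne_p] := (l, j) =P (l0.+1, L); first by left.
  have m_j : m l j.
    move: m'_j; rewrite m'E => /orP [//|/andP [/eqP el /eqP ej]].
    by case: ne_p; rewrite el ej.
  right; split.
    split=> // y m_y le_jy; have [|x m'_x lt_x] := end_j y _ le_jy.
      by rewrite m'E m_y.
    exists x => //; move: m'_x; rewrite m'E => /orP [//|/andP [/eqP el /eqP ex]].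
    have le_y := m_L _ _ m_y; have def_y : y = L by lia.
    by have := m_rows l.+1; rewrite -def_y m_y => /(_ isT); lia.
  apply/eqP => -[def_l def_j].
  have l0_gt0 : 0 < l0 by rewrite -def_l.
  have [m_k k_max] := last_k l0_gt0.
  have [||x m'_x lt_x] := end_j L.
  - by rewrite m'E def_l !eqxx orbT.
  - exact: m_L m_j.
  have : m l x.
    by move: m'_x; rewrite m'E def_l; case: eqP => [|_ /=]; [lia | rewrite orbF].
  by rewrite def_l => /k_max; lia.
case=> [[-> ->] | [[l_gt0 m_j end_j] ne_p]].
  split => //; first by rewrite m'E !eqxx orbT.
  move=> y; rewrite m'E => /orP [m_y le_y | /andP [/eqP]]; last lia.
  have def_y : y = L by have := m_L _ _ m_y; lia.
  by move: m_y; rewrite def_y => /m_rows; lia.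
split=> //; first by rewrite m'E m_j.
move=> y; rewrite m'E => /orP [m_y le_y | /andP [/eqP [def_l] /eqP ->] le_jL].
  by have [x m_x lt_x] := end_j y m_y le_y; exists x; rewrite // m'E m_x.
have [m_k k_max] : m l0 k /\ forall j, m l0 j -> j <= k by apply: last_k; rewrite -def_l.
exists k; first by rewrite m'E def_l m_k.
rewrite (m_L _ _ m_k) andbT ltn_neqAle k_max -?def_l // andbT.
by apply: contra ne_p => /eqP ->; rewrite def_l.
Qed.

Lemma room_rcons w x l j : j <= size w -> room (rcons w x) l j = room w l j.
Proof. by move=> le_j; rewrite /room /carrier -cats1 takel_cat. Qed.

Lemma E_rcons w x l j : E (rcons w x) l j =
  if j < size w then E w l j
  else if j == size w then minn (room w l (size w)) x.2 else 0.
Proof.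
rewrite E_room nth_rcons; case: ltngtP => [lt_j | _ | ->].
- by rewrite room_rcons ?E_room // ltnW.
- by rewrite minn0.
- by rewrite room_rcons.
Qed.

(** The sum condition says that the vacancy numbers of the rows t can be computed
from energies. *)
Definition chain_ends b t := [/\ uniq t,
  forall p, (p \in t) <-> chain_end (hit b) p
  & forall l, \sum_(p <- t) minn l p.1 = Etot b l].

Definition rigged_rows b (t : seq (nat * nat)) : seq (nat * int) :=
  [seq (p.1, rigging (map weight b) b p.1 p.2) | p <- t].

(** The invariant for phi.  The quantum space is reversed because the row under
construction is at its head. *)
Definition reads_off b (rc : rigged_conf) :=
  rc.1 = rev (map weight b) /\
  exists2 t, chain_ends b t & perm_eq rc.2 (rigged_rows b t).

Lemma riggingE b mu j : rigging (map weight b) b mu j =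
  ((width_sum b mu j)%:Z + (E b mu j)%:Z - 2 * (energy_sum b mu j.+1)%:Z)%R.
Proof.
rewrite /rigging /width_sum /energy_sum; congr (Posz _ + _ - _)%R.
apply: eq_bigr => i _; congr minn.
have [lt_i | ge_i] := ltnP i (size b); first by rewrite (nth_map (0, 0)).
by rewrite !nth_default ?size_map.
Qed.

Lemma vacancyE b mu k : \sum_(r <- mu) minn k r = Etot b k ->
  vacancy (rev (map weight b)) mu k =
  ((width_sum b k (size b))%:Z - 2 * (energy_sum b k (size b))%:Z)%R.
Proof.
rewrite /vacancy => ->; congr (Posz _ - _)%R.
rewrite (perm_big (map weight b)) ?perm_rev //= big_map.
by rewrite (big_nth (0, 0)) big_mkord.
Qed.

Lemma sum_rows b t rows k : chain_ends b t -> perm_eq rows (rigged_rows b t) ->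
  \sum_(r <- unzip1 rows) minn k r = Etot b k.
Proof.
case=> _ _ <- rows_t; rewrite (perm_big _ (perm_map fst rows_t)) /=.
by rewrite !big_map.
Qed.

Lemma eq_rigged_rows b b' t :
    (forall p, p \in t -> forall i, i < p.2 -> nth (0, 0) b i = nth (0, 0) b' i) ->
    (forall p, p \in t -> forall i, i <= p.2 -> E b p.1 i = E b' p.1 i) ->
  rigged_rows b t = rigged_rows b' t.
Proof.
move=> nth_eq E_eq; apply/eq_in_map => p t_p.
rewrite !riggingE (E_eq p t_p p.2) // /width_sum /energy_sum.
congr (_, Posz _ + _ - _ * Posz _)%R; apply: eq_bigr => i _.
  by rewrite (nth_eq p t_p).
by rewrite (E_eq p t_p) // -ltnS.
Qed.

Lemma eq_chain_end m m' p : m =2 m' -> chain_end m p <-> chain_end m' p.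
Proof.
move=> eq_m; split=> -[p_gt0 m_p end_p]; split=> //.
- by rewrite -eq_m.
- by move=> y; rewrite -eq_m => m_y /(end_p y m_y) [x m_x]; exists x; rewrite -?eq_m.
- by rewrite eq_m.
- by move=> y; rewrite eq_m => m_y /(end_p y m_y) [x m_x]; exists x; rewrite ?eq_m.
Qed.

Lemma reads_off_eq b b' rc rc' : rc'.1 = rev (map weight b') -> rc'.2 = rc.2 ->
    (forall l j, E b l j = E b' l j) -> (forall l, Etot b l = Etot b' l) ->
    (forall i, i < (size b').-1 -> nth (0, 0) b i = nth (0, 0) b' i) ->
  reads_off b rc -> reads_off b' rc'.
Proof.
move=> rc'1 rc'2 eqE eqEtot eq_nth [_ [t [uniq_t t_end t_sum] rc2]].
have eq_hit : hit b =2 hit b' by move=> l j; rewrite /hit !eqE.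
split=> //; exists t.
  by split=> // [p|l]; rewrite ?t_end ?t_sum //; apply: eq_chain_end.
rewrite rc'2 -(eq_rigged_rows (b := b)) // => p /t_end [_ hit_p _] i lt_i.
apply: eq_nth; move: hit_p; rewrite eq_hit => /hit_col; lia.
Qed.

(** A factor without letters opens the quantum space row of length 0. *)
Lemma reads_off_new w rc : reads_off w rc ->
  reads_off (rcons w (0, 0)) (0 :: rc.1, rc.2).
Proof.
move=> w_rc; have eqE l j : E w l j = E (rcons w (0, 0)) l j.
  rewrite E_rcons minn0; case: ltngtP => // [gt_j | ->]; apply: E_default => //.
  exact: ltnW.
apply: reads_off_eq (w_rc) => //=.
- by rewrite map_rcons rev_rcons; case: w_rc => ->.
- move=> l; rewrite /Etot size_rcons big_ord_recr /= -eqE E_default // addn0.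
  by apply: eq_bigr => i _; apply: eqE.
- by rewrite size_rcons => i lt_i; rewrite nth_rcons lt_i.
Qed.

Lemma reads_off_letter1 w x rc : reads_off (rcons w x) rc ->
  reads_off (rcons w (x.1.+1, x.2)) (letter1 rc).
Proof.
move=> w_rc.
have eqE l j : E (rcons w x) l j = E (rcons w (x.1.+1, x.2)) l j.
  by rewrite !E_rcons.
apply: reads_off_eq (w_rc) => //=.
- by case: w_rc => -> _; rewrite !map_rcons !rev_rcons.
- by move=> l; rewrite /Etot !size_rcons; apply: eq_bigr => i _; apply: eqE.
- by rewrite size_rcons => i lt_i; rewrite !nth_rcons lt_i.
Qed.

(** Here w consists of the completed factors and a letters 2 of the next factor
have been read; L is the column of that factor. *)
Section Letter2.

Variables (w : seq (nat * nat)) (a : nat) (rc : rigged_conf).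
Hypothesis w_rc : reads_off (rcons w (0, a)) rc.

Let b := rcons w (0, a).
Let b' := rcons w (0, a.+1).
Let L := size w.

Let size_b : size b = L.+1. Proof. exact: size_rcons. Qed.

Let nth_b : nth (0, 0) b L = (0, a).
Proof. by rewrite nth_rcons ltnn eqxx. Qed.

(** The number m is the length of the row that the next letter 2 prolongs. *)
Lemma jump_exists :
  exists m, forall l, (room w l L <= a) = (l <= m).
Proof.
have room_large : exists l, a < room w l L.
  exists (a + \sum_(i < L) (nth (0, 0) w i).2).+1.
  by have := room_lb w (a + \sum_(i < L) (nth (0, 0) w i).2).+1 L; lia.
case: (ex_minnP room_large) => -[|m] lt_m m_min.
  by have := room_ub w 0 L; lia.
exists m => l; apply/idP/idP => [le_a | le_l].
  rewrite leqNgt; apply/negP => /(room_mono w L); lia.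
by rewrite leqNgt; apply/negP => /m_min; lia.
Qed.

Variable m : nat.
Hypothesis jump : forall l, (room w l L <= a) = (l <= m).

Let jump_m : room w m L = a.
Proof. by have := jump m; have := jump m.+1; have := room_step w m L; lia. Qed.

Let E_b' l j : E b' l j = E b l j + ((m < l) && (j == L)).
Proof.
rewrite !E_rcons -/L /=; have := jump l.
by case: (ltngtP j L); rewrite ?andbF ?addn0 ?andbT //; lia.
Qed.

Let hit_b' l j : hit b' l j = hit b l j || (l == m.+1) && (j == L).
Proof.
rewrite /hit !E_b'; case: (j =P L) => [-> | _]; last by rewrite !andbF !addn0 orbF.
case: l => [|l]; first by [].
rewrite !andbT /= !E_rcons -/L ltnn eqxx /=.
have := jump l; have := jump l.+1; have := room_step w l L; lia.
Qed.

Let hit_le_L l j : hit b l j -> j <= L.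
Proof. by move/hit_col; rewrite size_b. Qed.

Let hit_L l : hit b l L -> l <= m.
Proof.
case: l => // l; rewrite hitE nth_b room_rcons //= => /andP [_ lt_a].
by have := jump l.+1; have := room_step w l L; lia.
Qed.

Let room_end l : room b l (size b) = room w l L - a.
Proof.
by rewrite size_b roomS nth_b room_rcons //= minn0 addn0; lia.
Qed.

Lemma last_hit : exists k, 0 < m -> hit b m k /\ forall j, hit b m j -> j <= k.
Proof.
have [m_gt0 | _] := ltnP 0 m; last by exists 0.
have hit_mL : hit b' m.+1 L by rewrite hit_b' !eqxx orbT.
have [x [hit_x _ _]] := interlaced_hit m_gt0 hit_mL.
have ex_hit : exists j, hit b m j.
  by exists x; move: hit_x; rewrite hit_b'; case: eqP => [|_]; [lia | rewrite orbF].
by have [k hit_k k_max] := ex_maxnP ex_hit (@hit_le_L m); exists k.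
Qed.

Variable k : nat.
Hypothesis last_k : 0 < m -> hit b m k /\ forall j, hit b m j -> j <= k.

Let chain_end_b' p :
  chain_end (hit b') p <-> p = (m.+1, L) \/ chain_end (hit b) p /\ p != (m, k).
Proof. exact: chain_end_add hit_b' hit_le_L hit_L (@interlaced_hit b') last_k p. Qed.

Let chain_end_mk : 0 < m -> chain_end (hit b) (m, k).
Proof.
move=> m_gt0; have [hit_k k_max] := last_k m_gt0; split=> //= y hit_y le_ky.
have lt_y : y < L.
  rewrite ltn_neqAle (hit_le_L hit_y) andbT; apply: contraTN hit_y => /eqP ->.
  by apply/negP => /hit_L; rewrite ltnn.
have hit_mL : hit b' m.+1 L by rewrite hit_b' !eqxx orbT.
have [x [hit_x _ x_gt]] := interlaced_hit m_gt0 hit_mL.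
have lt_yx := x_gt y _ lt_y; have : hit b m x.
  by move: hit_x; rewrite hit_b'; case: eqP => [|_]; [lia | rewrite orbF].
by move/k_max; have := lt_yx _; rewrite hit_b' hit_y => /(_ isT); lia.
Qed.

Section Ends.

Variable t : seq (nat * nat).
Hypothesis t_ends : chain_ends b t.
Hypothesis rows_t : perm_eq rc.2 (rigged_rows b t).

Let rc1 : rc.1 = rev (map weight b). Proof. by case: w_rc. Qed.

Let vac l : vacancy rc.1 (unzip1 rc.2) l =
  ((width_sum b l (size b))%:Z - 2 * (energy_sum b l (size b))%:Z)%R.
Proof. by rewrite rc1 vacancyE //; apply: sum_rows t_ends rows_t. Qed.

Lemma singular_le row : row \in rc.2 -> singular rc row -> 0 < row.1 <= m.
Proof.
case: t_ends => _ t_end _; rewrite (perm_mem rows_t) => /mapP [[l j] t_p ->].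
have [/= l_gt0 hit_j _] := (t_end _).1 t_p.
rewrite /singular /= vac riggingE l_gt0 -jump -subn_eq0 -room_end => /eqP eq_r.
have := room_gap hit_j (hit_col hit_j); lia.
Qed.

(** The chain ending at the last 1 of row m gives a singular row: since then
d_m has been zero and d_(m+1) one. *)
Lemma rigging_last : 0 < m ->
  rigging (map weight b) b m k = vacancy rc.1 (unzip1 rc.2) m.
Proof.
move=> m_gt0; rewrite vac riggingE; have [hit_k k_max] := last_k m_gt0.
have [_ _ /= end_k] := chain_end_mk m_gt0.
suff : room b m (size b) + 2 * energy_sum b m (size b) + (width_sum b m k + E b m k)
    = width_sum b m (size b) + 2 * energy_sum b m k.+1.
  by rewrite room_end jump_m subnn; lia.
apply: room_gap_eq hit_k (hit_col hit_k) _ _ _ _.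
- by move=> i /andP [lt_ki _]; apply/negP => /k_max; lia.
- move=> i /andP [le_ki _]; apply/negP => /end_k /(_ le_ki) [x /k_max]; lia.
- by rewrite !room_end jump_m subnn; apply/eqP; rewrite subn_eq0 jump; lia.
- by rewrite !room_end jump_m subnn; have := jump m.+1; lia.
Qed.

Let sing := filter (singular rc) rc.2.

Lemma nilp_sing : nilp sing = (m == 0).
Proof.
rewrite /nilp /sing size_filter -leqn0 leqNgt -has_count.
have [m_eq0 | m_gt0] := posnP m.
  apply/hasPn => row rc_row; apply/negP => /(singular_le rc_row); lia.
apply/negbF/hasP; exists (m, rigging (map weight b) b m k); last first.
  by rewrite /singular /= rigging_last.
case: t_ends => _ t_end _; rewrite (perm_mem rows_t).
by apply/mapP; exists (m, k) => //; apply/t_end/chain_end_mk.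
Qed.

Lemma max_sing : \max_(row <- sing) row.1 = m.
Proof.
apply/eqP; rewrite eqn_leq; apply/andP; split.
  apply/bigmax_leqP_seq => row; rewrite mem_filter => /andP [sing_row rc_row] _.
  by case/andP: (singular_le rc_row sing_row).
have [-> // | m_gt0] := posnP m.
apply: (@leq_bigmax_seq _ _ xpredT (fun row : nat * int => row.1)
         (m, rigging (map weight b) b m k)) => //.
rewrite mem_filter /singular /= rigging_last // eqxx /= -rigging_last //.
case: t_ends => _ t_end _.
by rewrite (perm_mem rows_t); apply/mapP; exists (m, k) => //; apply/t_end/chain_end_mk.
Qed.

Let t' := (m.+1, L) :: rem (m, k) t.

Lemma chain_ends_letter2 : chain_ends b' t'.
Proof.
case: t_ends => uniq_t t_end t_sum; split.
- rewrite /= rem_uniq // andbT; apply/negP => /mem_rem /t_end [_ /= /hit_L].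
  by rewrite ltnn.
- move=> p; rewrite inE mem_rem_uniq // inE /= chain_end_b'.
  split=> [/orP [/eqP -> | /andP [ne_p /t_end]] | [-> | [/t_end t_p ne_p]]];
    rewrite ?eqxx; auto.
  by rewrite ne_p t_p orbT.
move=> l; rewrite big_cons /=.
have -> : Etot b' l = Etot b l + (m < l).
  rewrite /Etot !size_rcons !big_ord_recr /= !E_b' eqxx andbT addnA.
  congr (_ + _ + _); apply: eq_bigr => i _.
  by rewrite E_b' ltn_eqF ?andbF ?addn0 //; apply: (ltn_ord i).
have -> : Etot b l = minn l m + \sum_(p <- rem (m, k) t) minn l p.1; last first.
  by rewrite addnAC; congr (_ + _); lia.
rewrite -t_sum; have [m_eq0 | m_gt0] := posnP m.
  rewrite m_eq0 minn0 rem_id //; apply/negP => /t_end [/=]; lia.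
by rewrite (perm_big _ (perm_to_rem ((t_end _).2 (chain_end_mk m_gt0)))) big_cons.
Qed.

Let others := if nilp sing then rc.2 else rem (m, vacancy rc.1 (unzip1 rc.2) m) rc.2.

Lemma others_rows : perm_eq others (rigged_rows b' (rem (m, k) t)).
Proof.
case: t_ends => uniq_t t_end _.
rewrite -(eq_rigged_rows (b := b)); first last.
- move=> p /mem_rem /t_end [_ hit_p _] i le_i; rewrite E_b'.
  case: (i =P L) => [eq_i | _]; last by rewrite andbF addn0.
  have eq_p : p.2 = L by have := hit_le_L hit_p; lia.
  by move: hit_p; rewrite eq_p => /hit_L; rewrite leqNgt => /negPf ->; rewrite addn0.
- move=> p /mem_rem /t_end [_ /hit_le_L le_L _] i lt_i.
  by rewrite !nth_rcons (leq_trans lt_i le_L).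
rewrite /others nilp_sing; have [m_eq0 | m_gt0] := posnP m.
  by rewrite rem_id //; apply/negP => /t_end [/=]; rewrite m_eq0.
rewrite -rigging_last //.
have t_mk := (t_end _).2 (chain_end_mk m_gt0).
have rc_mk : (m, rigging (map weight b) b m k) \in rc.2.
  by rewrite (perm_mem rows_t); apply/mapP; exists (m, k).
rewrite -(perm_cons (m, rigging (map weight b) b m k)).
rewrite -(permPl (perm_to_rem rc_mk)) (permPl rows_t).
exact: perm_map (perm_to_rem t_mk).
Qed.

Lemma reads_off_letter2_aux : reads_off b' (letter2 rc).
Proof.
have grow : grow_quantum rc.1 = rev (map weight b').
  by rewrite rc1 !map_rcons !rev_rcons.
rewrite /letter2 -/sing max_sing -/others grow; split=> //=.
exists t'; first exact: chain_ends_letter2.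
suff -> : vacancy (rev (map weight b')) (m.+1 :: unzip1 others) m.+1
    = rigging (map weight b') b' m.+1 L.
  by rewrite perm_cons others_rows.
have rows_t' : perm_eq ((m.+1, rigging (map weight b') b' m.+1 L) :: others)
    (rigged_rows b' t') by rewrite perm_cons others_rows.
have /= sum_t' := sum_rows m.+1 chain_ends_letter2 rows_t'.
rewrite vacancyE // riggingE size_rcons -/L.
rewrite /width_sum !big_ord_recr /= {2}/b' nth_rcons ltnn eqxx /weight.
rewrite E_rcons ltnn eqxx -/L /=.
have -> : room w m.+1 L = a.+1.
  by have := jump m.+1; have := room_step w m L; rewrite jump_m; lia.
have -> : minn m.+1 a.+1 = a.+1 by have := room_ub w m L; rewrite jump_m; lia.
by rewrite minnn PoszD.
Qed.

End Ends.
End Letter2.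

Lemma reads_off_letter2 w a rc : reads_off (rcons w (0, a)) rc ->
  reads_off (rcons w (0, a.+1)) (letter2 rc).
Proof.
move=> w_rc; have [m jump] := jump_exists w a.
have [k last_k] := last_hit jump; have [_ [t t_ends rows_t]] := w_rc.
exact: (reads_off_letter2_aux w_rc jump (k := k) last_k t_ends rows_t).
Qed.

Lemma reads_off_phi b : reads_off b (phi b).
Proof.
elim/last_ind: b => [|w [x1 x2] IHw].
  split=> //; exists [::] => //; split=> // [p | l].
    2: by rewrite big_nil /Etot big_ord0.
  by split=> // -[_ /hit_col].
rewrite /phi foldl_rcons -/(phi w) /process /=.
elim: x1 => [|x1 IHx1] /=; last exact: (reads_off_letter1 IHx1).
by elim: x2 => [|x2 IHx2] /=; [apply: reads_off_new | apply: reads_off_letter2].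
Qed.

(** * The procedure applied to the energy table *)

Lemma is_one_hit b : is_one (size b) (energy_table b) =2 hit b.
Proof.
move=> l j; rewrite /is_one /energy_table /hit.
by have [lt_j | ge_j] := ltnP j (size b); [lia | rewrite !E_default].
Qed.

Lemma Etot1 b : Etot b 1 = \sum_(j < size b) is_one (size b) (energy_table b) 1 j.
Proof.
apply: eq_bigr => j _; rewrite is_one_hit hitE E_room.
have := room_step b 0 j; have := room_ub b 0 j; lia.
Qed.

(** Erasing is the only change made to a table, so that entries that were 0 or 1
remain so. *)
Lemma procedure_zero L T s T' : procedure L T s T' ->
  forall l j, T' l j != T l j -> T' l j = 0%R.
Proof.
elim=> {T s T'} [T | T c s T' _ _ IH] l j; first by rewrite eqxx.
have [-> | /IH //] := eqVneq (T' l j) (erase T c l j).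
by rewrite /erase; case: ifP => // _; rewrite eqxx.
Qed.

Theorem theorem4p1 (L : nat) (lam : L.-tuple nat) (b : L.-tuple (nat * nat))
    (hL : 0 < L) (hlam : forall i : 'I_L, 0 < tnth lam i)
    (hb : forall i : 'I_L, tnth b i \in B (tnth lam i)) :
  (* every run of the procedure can be continued up to N = E_1(b) selections *)
  (forall (s : seq (nat * nat)) (T : table),
      procedure L (energy_table b) s T -> size s < Etot b 1 ->
      exists c : seq nat, selection L T c) /\
  (* whatever the choices, after N selections the table is zero and the
     positions found determine phi(b) *)
  (forall (s : seq (nat * nat)) (T : table),
      procedure L (energy_table b) s T -> size s = Etot b 1 ->
      (forall l j : nat, 0 < l -> j < L -> T l j = 0%R) /\
      same_rc (tval lam, [seq (p.1, rigging lam b p.1 p.2) | p <- s]) (phi b)).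
Proof.
have size_bL : size b = L by rewrite size_tuple.
have lamE : tval lam = map weight b.
  apply: (@eq_from_nth _ 0) => [|i]; rewrite !size_tuple // => lt_i.
  rewrite (nth_map (0, 0)) ?size_tuple //.
  have := hb (Ordinal lt_i); rewrite /in_mem /= /B !(tnth_nth (0, 0)) !(tnth_nth 0).
  by move/eqP <-.
have one_hit : is_one L (energy_table b) =2 hit b.
  by rewrite -[X in is_one X]size_bL; apply: is_one_hit.
have oneI : interlaced (is_one L (energy_table b)).
  move=> l y l_gt0; rewrite one_hit => /(interlaced_hit l_gt0) [x [hit_x le_x x_gt]].
  by exists x; split; rewrite ?one_hit // => y'; rewrite one_hit; apply: x_gt.
have Etot_one : Etot b 1 = \sum_(j < L) is_one L (energy_table b) 1 j.
  by rewrite Etot1 size_bL.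
split=> s T run size_s; have [TI uniq_s s_end s_gone count_s] := procedureP run oneI.
  apply: (select_exists (M := \sum_(i < size b) (nth (0, 0) b i).2) TI).
    move=> l j /hit_bounded no_hit.
    have {no_hit} no_hit : ~~ hit b l j by apply: no_hit.
    apply: contra no_hit => /andP [lt_j /eqP T_lj].
    rewrite -one_hit /is_one lt_j /=.
    have [<-|] := eqVneq (T l j) (energy_table b l j); first by rewrite T_lj.
    by move/(procedure_zero run); rewrite T_lj.
  by move: size_s; rewrite Etot_one count_s; lia.
have no_one : forall l j, 0 < l -> ~~ is_one L T l j.
  apply: no_one_interlaced TI _ => j; apply/negP => one_j.
  have lt_j : j < L by case/andP: one_j.
  move: count_s; rewrite -Etot_one -size_s (bigD1 (Ordinal lt_j)) //= one_j; lia.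
split=> [l j l_gt0 lt_j|].
  have [eq_T | /(procedure_zero run) //] := eqVneq (T l j) (energy_table b l j).
  have := no_one l j l_gt0; rewrite /is_one lt_j eq_T /energy_table /=.
  by have := E_step b l.-1 j; rewrite prednK //; lia.
have [phi1 [t [uniq_t t_end _] phi2]] := reads_off_phi b.
rewrite /same_rc /= phi1 lamE; apply/andP; split; first by rewrite perm_sym perm_rev.
rewrite perm_sym (permPl phi2); apply: perm_map; apply: uniq_perm => // p.
apply/idP/idP => [/t_end /(eq_chain_end _ one_hit) /s_end [// | [p_gt0]] | s_p].
  by rewrite (negPf (no_one _ _ p_gt0)).
by apply/t_end/(eq_chain_end _ one_hit)/s_end; left.
Qed.
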